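(* Let $k\in\mathbb{N}$ be a constant and let $d$ be a constant degree bound. Then: (i) there exists a $(k,O(1/\varepsilon))$-round-adaptive tester with one-sided error for $(2k+1)$-cycle freeness in the bounded-degree graph model; yet (ii) any $(k-1,q)$-round-adaptive (two-sided error) tester for $(2k+1)$-cycle freeness in the bounded-degree graph model must satisfy $q=\Omega(\sqrt{n})$, where $n$ is the number of vertices.
   Context: Bounded-degree graph model: a graph $G=(V,E)$ with $|V|=n$ and maximum degree at most a constant $d<n$ is represented by its adjacency-list function $g\colon V\times[d]\to V\cup\{0\}$, where $g(v,i)$ is the $i$-th neighbor of $v$, or $0$ if $v$ has fewer than $i$ neighbors. The distance of $G$ from a property (an isomorphism-closed set of such graphs) is the minimal fraction of the $dn$ entries of $g$ that must be changed to obtain a member of the property. A $(k,q)$-round-adaptive tester: given proximity parameter $\varepsilon\in(0,1]$ and query access to $g$, proceeds in $k+1$ rounds, in round $\ell\ge0$ choosing a set of pairs $(v,i)$ based on its randomness and answers from earlier rounds and receiving $g(v,i)$; the total number of queries is $q$; it accepts with probability $\ge2/3$ graphs in the property and rejects with probability $\ge2/3$ graphs at distance more than $\varepsilon$. One-sided error means graphs in the property are always accepted. A graph is $t$-cycle free if it contains no cycle of length at most $t$. *)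

(* Defs.v *)
From HB Require Import structures.
From mathcomp Require Import all_boot all_order all_algebra.
From mathcomp Require Import all_classical all_reals all_analysis.

Set Implicit Arguments.
Unset Strict Implicit.
Unset Printing Implicit Defensive.

Import Order.TTheory GRing.Theory Num.Theory.
Local Open Scope classical_set_scope.
Local Open Scope ring_scope.

Record graph (n : nat) := Graph {
  edge :> rel 'I_n;
  edge_sym : symmetric edge;
  edge_irr : irreflexive edge }.

(* A simple cycle is a duplicate-free cyclic sequence of at least three
   vertices; [ucycle] alone also holds of [::] and of the two ends of an edge. *)
Definition cycle_free (t n : nat) (G : graph n) : Prop :=
  forall c : seq 'I_n, ucycle G c -> (3 <= size c)%N -> (t < size c)%N.

(* Adjacency-list functions: [None] plays the role of the symbol 0. *)
Definition adjlist (n d : nat) := {ffun 'I_n * 'I_d -> option 'I_n}.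

(* [s] lists the neighbours of [v]; [onth s i] is [None] when [size s <= i].
   In particular the maximum degree of [G] is at most [d]. *)
Definition represents (n d : nat) (g : adjlist n d) (G : graph n) : Prop :=
  forall v, exists s : seq 'I_n,
    [/\ uniq s, (size s <= d)%N, (forall w, (w \in s) = G v w)
      & forall i : 'I_d, g (v, i) = onth s i].

(* The fractions are at most 1, so starting the minimum at 1 only matters for
   an empty property. *)
Definition dist (R : realType) (n d : nat)
    (g : adjlist n d) (P : graph n -> Prop) : R :=
  \big[Num.min/1]_(g' : adjlist n d | `[< exists2 G, represents g' G & P G >])
    (#|[pred x | g x != g' x]|%:R / (d * n)%:R).

(* What one round reveals: [Some (g x)] at the queried entries. *)
Definition view (n d : nat) :=
  {ffun 'I_n * 'I_d -> option (option 'I_n)}.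

Definition answers (n d : nat) (g : adjlist n d) (Q : {set 'I_n * 'I_d}) :
    view n d :=
  [ffun x => if x \in Q then Some (g x) else None].

(* The coins live in an arbitrary probability space. A history lists the views
   of the earlier rounds in order, so its size is the index of the current
   round. *)
Record algorithm (R : realType) (n d : nat) := Algorithm {
  coin_display : measure_display;
  coins : measurableType coin_display;
  coin_law : probability coins R;
  queries : coins -> seq (view n d) -> {set 'I_n * 'I_d};
  verdict : coins -> seq (view n d) -> bool;
  measurable_queries : forall h Q, measurable [set w | queries w h = Q];
  measurable_verdict : forall h, measurable [set w | verdict w h] }.

Section Run.
Variables (R : realType) (n d : nat) (A : algorithm R n d).

Fixpoint history (g : adjlist n d) (w : coins A) (r : nat) : seq (view n d) :=
  if r is r'.+1 then
    let h := history g w r' in rcons h (answers g (queries w h))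
  else [::].

Definition num_queries (r : nat) (g : adjlist n d) (w : coins A) : nat :=
  \sum_(l < r) #|queries w (history g w l)|.

Definition accepts (r : nat) (g : adjlist n d) (w : coins A) : bool :=
  verdict w (history g w r).

(* A k-round-adaptive algorithm has k + 1 rounds, numbered from 0 to k. *)
Definition round_adaptive_tester (k q : nat) (eps : R)
    (P : graph n -> Prop) : Prop :=
  [/\ forall G g w, represents g G -> (num_queries k.+1 g w <= q)%N,
      forall G g, represents g G -> P G ->
        ((2 / 3)%:E <= coin_law A [set w | accepts k.+1 g w])%E
    & forall G g, represents g G -> eps < dist R g P ->
        ((2 / 3)%:E <= coin_law A [set w | ~~ accepts k.+1 g w])%E].

Definition one_sided (k : nat) (P : graph n -> Prop) : Prop :=
  forall G g w, represents g G -> P G -> accepts k.+1 g w.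

End Run.

(* Main.v *)
(** For (i), the vertices lying on cycles of length at most 2k+1 number at
    least eps n in an eps-far graph, since deleting the edges among them
    destroys all these cycles and only changes their own rows. So O(1/eps)
    random vertices hit one, and breadth-first search from it has queried the
    whole cycle by round k, each vertex of it being within distance k.

    For (ii), compare randomly labelled disjoint (4k+2)-cycles with randomly
    labelled disjoint pairs of (2k+1)-cycles: on a blob of places Z/(4k+2), join
    [u] to [u+1], respectively to [u+2]. In [k] rounds an algorithm entering a
    blob only once, at [s], queries places [s+u] with |u| < k, and the map
    [s+u |-> s+2u] carries what it sees in the first graph to what it sees in the
    second. Applied blob by blob, this is an injection on the labellings for
    which no blob is entered twice, and it preserves the whole transcript. By a
    birthday bound the other labellings have density O(q^2/n). *)

From HB Require Import structures.
Require Import Defs.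
From mathcomp Require Import all_boot all_order all_algebra perm.
From mathcomp Require Import all_classical all_reals all_analysis.
From mathcomp Require Import measurable_realfun.
From mathcomp Require Import zify ring lra.
(* Imported again so that [set0], [subsetP], etc. denote the finite-set versions. *)
From mathcomp Require Import fintype finset.

Import Order.TTheory GRing.Theory Num.Theory.
Local Open Scope ring_scope.

Set Implicit Arguments.
Unset Strict Implicit.
Unset Printing Implicit Defensive.

(** * Testing by breadth-first search *)

Section Exploration.
Variables (n d : nat).
Implicit Types (r : {set 'I_n}) (h : seq (view n d)) (g : adjlist n d).

(** The relation is directed: an edge is recorded only at the end whose row was read. *)
Definition seen h : rel 'I_n := fun x y =>
  has (fun f : view n d => [exists i, f (x, i) == Some (Some y)]) h.

Definition known r h : {set 'I_n} := r :|: [set y | [exists x, seen h x y]].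

Definition no_short_cycle_seen t h : bool :=
  `[< forall c, ucycle (seen h) c -> (3 <= size c)%N -> (t < size c)%N >].

Lemma seen_rcons h (f : view n d) x y :
  seen (rcons h f) x y = [exists i, f (x, i) == Some (Some y)] || seen h x y.
Proof. by rewrite /seen has_rcons. Qed.

Lemma known_rcons r h f : known r h \subset known r (rcons h f).
Proof.
apply/subsetP => y; rewrite !inE => /orP[-> //|/existsP[x xy]].
by apply/orP; right; apply/existsP; exists x; rewrite seen_rcons xy orbT.
Qed.

(** Rows already read are queried again, at the cost of a constant factor, so that one round alone
    shows all edges at the vertices known before it. *)
Definition frontier r h : {set 'I_n * 'I_d} := [set x | x.1 \in known r h].

Lemma card_frontier r h : #|frontier r h| = (#|known r h| * d)%N.
Proof.
have -> : frontier r h = setX (known r h) [set: 'I_d].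
  by apply/setP => -[x i]; rewrite !inE andbT.
by rewrite cardsX cardsT card_ord.
Qed.

Lemma seen_answers g r h x y i : x \in known r h -> g (x, i) = Some y ->
  seen (rcons h (answers g (frontier r h))) x y.
Proof.
move=> xh gxi; rewrite seen_rcons; apply/orP; left.
by apply/existsP; exists i; rewrite ffunE inE /= xh gxi.
Qed.

Lemma known_answers g r h y : y \in known r (rcons h (answers g (frontier r h))) ->
  y \in known r h \/ exists x i, x \in known r h /\ g (x, i) = Some y.
Proof.
rewrite inE => /orP[yr|]; first by left; rewrite inE yr.
rewrite inE => /existsP[x]; rewrite seen_rcons => /orP[/existsP[i]|xy].
  by rewrite ffunE inE /=; case: ifP => // xh /eqP[gxi]; right; exists x, i.
by left; rewrite !inE; apply/orP; right; apply/existsP; exists x.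
Qed.

Lemma card_known_answers g r h :
  (#|known r (rcons h (answers g (frontier r h)))| <= #|known r h| * d.+1)%N.
Proof.
set S := known r h.
(* An empty entry defaults to its own row vertex; only the length of this list matters. *)
have sub : known r (rcons h (answers g (frontier r h))) \subset
    S :|: [set y | y \in [seq odflt x.1 (g x) | x <- enum (setX S [set: 'I_d])]].
  apply/subsetP => y /known_answers[yS|[x [i [xS gxi]]]]; apply/setUP.
    by left.
  right; rewrite inE; apply/mapP; exists (x, i); last by rewrite gxi.
  by rewrite mem_enum in_setX xS in_setT.
apply: (leq_trans (subset_leq_card sub)).
apply: (leq_trans (leq_card_setU _ _)).
rewrite mulnS leq_add2l cardsE.
apply: (leq_trans (card_size _)).
by rewrite size_map -cardE cardsX cardsT card_ord.
Qed.

End Exploration.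

(** * Query count, one-sidedness and cycle detection of the search *)

Section Tester.
Variables (R : realType) (n d : nat) (law : probability nat R).
Variables (roots : nat -> {set 'I_n}) (t : nat).

Definition bfs_tester : algorithm R n d :=
  @Algorithm R n d _ nat law (fun w => frontier (roots w))
    (fun _ => no_short_cycle_seen t) (fun _ _ => I) (fun _ => I).

Local Notation H g w l := (@history R n d bfs_tester g w l).

Lemma card_known_bfs g (w : nat) l :
  (#|known (roots w) (H g w l)| <= #|roots w| * d.+1 ^ l)%N.
Proof.
elim: l => [|l IH].
  rewrite muln1 subset_leq_card //; apply/subsetP => x.
  by rewrite !inE => /orP[//|/existsP[]].
apply: (@leq_trans (#|known (roots w) (H g w l)| * d.+1)%N).
  exact: card_known_answers.
by rewrite expnSr mulnA leq_mul2r IH orbT.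
Qed.

Lemma num_queries_bfs g (w : nat) k m : (#|roots w| <= m)%N ->
  (@num_queries R n d bfs_tester k.+1 g w <= k.+1 * (m * d.+1 ^ k.+1))%N.
Proof.
move=> rm; rewrite /num_queries.
apply: (@leq_trans (\sum_(l < k.+1) m * d.+1 ^ k.+1)%N); last first.
  by rewrite sum_nat_const card_ord.
apply: leq_sum => l _.
have -> : @queries R n d bfs_tester w (H g w l) = frontier (roots w) (H g w l).
  by [].
rewrite card_frontier.
apply: (@leq_trans (#|roots w| * d.+1 ^ l * d.+1)%N).
  by rewrite leq_mul // card_known_bfs.
by rewrite -mulnA -expnSr leq_mul // leq_pexp2l.
Qed.

Lemma seen_history_entry g (w : nat) l x y : seen (H g w l) x y ->
  exists i, g (x, i) = Some y.
Proof.
elim: l => //= l IH; rewrite seen_rcons => /orP[/existsP[i]|//].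
by rewrite ffunE; case: ifP => // _ /eqP[e]; exists i.
Qed.

Lemma entry_edge g (G : graph n) x y : represents g G ->
  G x y <-> exists i : 'I_d, g (x, i) = Some y.
Proof.
move=> /(_ x)[s [us sd sG sg]]; rewrite -sG.
split=> [/onthP[i e]|[i]]; last by rewrite sg => e; apply/onthP; exists i.
have id : (i < d)%N by apply: leq_trans sd; rewrite -onthTE e.
by exists (Ordinal id); rewrite sg.
Qed.

Lemma bfs_accepts g (G : graph n) (w : nat) l :
  represents g G -> cycle_free t G -> @accepts R n d bfs_tester l g w.
Proof.
move=> gG free; apply/asboolP => c /andP[cyc uc]; apply: free.
rewrite /ucycle uc andbT; move: cyc; apply: sub_cycle => x y xy.
by apply/(entry_edge x y gG); apply: seen_history_entry xy.
Qed.

Lemma known_history g (w : nat) l l' x : (l <= l')%N ->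
  x \in known (roots w) (H g w l) -> x \in known (roots w) (H g w l').
Proof.
elim: l' => [|l' IH]; first by rewrite leqn0 => /eqP->.
rewrite leq_eqVlt => /orP[/eqP->//|] /IH{}IH /IH xl.
exact: (subsetP (known_rcons _ _ _) _ xl).
Qed.

Lemma known_step g (G : graph n) (w : nat) l x y : represents g G -> G x y ->
  x \in known (roots w) (H g w l) -> y \in known (roots w) (H g w l.+1).
Proof.
move=> gG /(entry_edge _ _ gG)[i gxi] xl.
rewrite /= !inE; apply/orP; right; apply/existsP; exists x.
exact: seen_answers xl gxi.
Qed.

(** Going around the cycle from a root both ways, the search knows the vertices at distance [j]
    after [j] rounds. As the length is at most $2k+1$, all vertices are known before round [k],
    which then reads all their rows. *)
Lemma bfs_rejects g (G : graph n) (w : nat) k (c : seq 'I_n) :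
  represents g G -> ucycle G c -> (3 <= size c <= k.*2.+1)%N -> (size c <= t)%N ->
  has (mem (roots w)) c -> ~~ @accepts R n d bfs_tester k.+1 g w.
Proof.
move=> gG cyc /andP[c3 ck] ct /hasP[r rc /= rw].
have [i c' rot_c] := rot_to rc.
have {c cyc c3 ck ct rc rot_c} [cyc c3 ck ct] : [/\ ucycle G (r :: c'),
    (3 <= size (r :: c'))%N, (size (r :: c') <= k.*2.+1)%N &
    (size (r :: c') <= t)%N].
  by rewrite -rot_c rot_ucycle size_rot.
have [cycG uc] := andP cyc.
pose v := nth r (r :: c').
have edge_v j : (j.+1 < size (r :: c'))%N -> G (v j) (v j.+1).
  by move: cycG; rewrite /= rcons_path => /andP[/(pathP r) h _]; apply: h.
have fwd j : (j < size (r :: c'))%N -> v j \in known (roots w) (H g w j).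
  elim: j => [_|j IH lt_j]; first by rewrite /v /= inE rw.
  exact: known_step gG (edge_v _ lt_j) (IH (ltnW lt_j)).
(* Index [size - j] lies [j] steps behind the root; the first of these steps is the closing edge. *)
have bwd j : (0 < j < size (r :: c'))%N ->
    v (size (r :: c') - j)%N \in known (roots w) (H g w j).
  elim: j => // -[_ _|j IH /andP[_ lt_j]].
    have last_r : G (v (size (r :: c') - 1)%N) r.
      move: cycG; rewrite /= rcons_path => /andP[_].
      by rewrite subn1 /v /= (nth_last r (r :: c')).
    apply: known_step gG _ (_ : r \in known (roots w) (H g w 0)).
      by rewrite edge_sym.
    by rewrite inE rw.
  apply: known_step gG _ (IH _); last by lia.
  rewrite edge_sym; have -> : (size (r :: c') - j.+1)%N =
    (size (r :: c') - j.+2).+1 by lia.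
  by apply: edge_v; lia.
have allk x : x \in r :: c' -> x \in known (roots w) (H g w k).
  move=> /(nthP r)[j lt_j <-]; have [jk|kj] := leqP j k.
    exact: known_history jk (fwd _ lt_j).
  have := bwd (size (r :: c') - j)%N.
  rewrite (subKn (ltnW lt_j)) => h.
  by apply: known_history (h _); lia.
apply/negP => /asboolP /(_ (r :: c')) no_cycle.
suff cyc_seen : ucycle (seen (H g w k.+1)) (r :: c').
  by have := no_cycle cyc_seen c3; rewrite ltnNge ct.
rewrite /ucycle uc andbT; move: cycG.
apply: (@sub_in_cycle _ (mem (r :: c'))); last exact/allP.
move=> x y xc _ /(entry_edge _ _ gG)[j gxj]; have xk := allk x xc.
exact: seen_answers xk gxj.
Qed.

End Tester.

(** * Distance and the number of vertices on short cycles *)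

Section Distance.
Variables (R : realType) (n d t : nat) (g : adjlist n d) (G : graph n).
Hypothesis gG : represents g G.

Definition on_short_cycle : {set 'I_n} := [set x |
  `[< exists c, [/\ ucycle G c, (3 <= size c <= t)%N & x \in c] >]].
Local Notation B := on_short_cycle.

(** Every edge of a short cycle has both ends in [B], and dropping all edges inside [B] leaves the
    rows of the other vertices intact. *)
Definition pruned_rel : rel 'I_n :=
  fun x y => G x y && ~~ ((x \in B) && (y \in B)).

Lemma pruned_sym : symmetric pruned_rel.
Proof. by move=> x y; rewrite /pruned_rel edge_sym [(x \in B) && _]andbC. Qed.

Lemma pruned_irr : irreflexive pruned_rel.
Proof. by move=> x; rewrite /pruned_rel edge_irr. Qed.

Definition pruned : graph n := Graph pruned_sym pruned_irr.

(** Rows outside [B] are copied together with their order, so that no entry there counts as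
    changed. *)
Definition pruned_adjlist : adjlist n d := [ffun vi : 'I_n * 'I_d =>
  if vi.1 \in B then onth [seq w <- enum 'I_n | pruned_rel vi.1 w] vi.2 else g vi].

Lemma pruned_represents : represents pruned_adjlist pruned.
Proof.
move=> v; have [s [us sd sG sg]] := gG v; have [vB|vB] := boolP (v \in B).
  exists [seq w <- enum 'I_n | pruned_rel v w]; split.
  - by rewrite filter_uniq ?enum_uniq.
  - apply: leq_trans sd; apply: uniq_leq_size; first by rewrite filter_uniq ?enum_uniq.
    by move=> w; rewrite mem_filter sG => /andP[/andP[]].
  - by move=> w; rewrite mem_filter mem_enum andbT.
  - by move=> i; rewrite ffunE /= vB.
exists s; split => // [w|i]; last by rewrite ffunE /= (negPf vB).
by rewrite sG /= /pruned_rel (negPf vB) andbT.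
Qed.

Lemma pruned_cycle_free : cycle_free t pruned.
Proof.
move=> c /andP[cyc uc] c3; rewrite ltnNge; apply/negP => ct.
have cB x : x \in c -> x \in B.
  move=> xc; rewrite inE; apply/asboolP; exists c; split=> //; last by rewrite c3.
  by rewrite /ucycle uc andbT; move: cyc; apply: sub_cycle => y z /andP[].
case: c cyc uc c3 ct cB => // x [//|y c] /= /andP[/andP[_ xy] _] _ _ _ cB.
by case/negP: xy; rewrite !cB ?inE ?eqxx ?orbT.
Qed.

Lemma dist_le_on_short_cycle : (0 < n)%N ->
  dist R g (@cycle_free t n) <= #|B|%:R / n%:R.
Proof.
move=> n0; apply: (@bigmin_inf _ _ _ _ pruned_adjlist).
  by apply/asboolP; exists pruned; [exact: pruned_represents|exact: pruned_cycle_free].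
(* For [d = 0] the distance is bounded by a division by zero, which is 0 by convention. *)
have [d0|d0] := posnP d.
  by rewrite [in (d * n)%N]d0 mul0n invr0 mulr0 divr_ge0.
rewrite natrM invfM mulrA ler_wpM2r ?invr_ge0 //.
rewrite ler_pdivrMr ?ltr0n // -natrM ler_nat.
have -> : (#|B| * d)%N = #|setX B [set: 'I_d]| by rewrite cardsX cardsT card_ord.
apply: subset_leq_card; apply/subsetP => -[v i]; rewrite in_setX in_setT andbT.
have [//|vB] := boolP (v \in B).
by rewrite inE /= ffunE /= (negPf vB) eqxx.
Qed.

End Distance.

(** * Uniform laws on initial segments of the natural numbers *)

Section UniformLaw.
Variables (R : realType) (N : nat).

(** On [nat] every set is measurable, which makes the measurability fields of the tester trivial. *)
Definition uniform_nat : set nat -> \bar R :=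
  mscale (((N.+1)%:R : R)^-1)%:nng (msum (fun i : nat => \d_i) N.+1).

HB.instance Definition _ := Measure.on uniform_nat.

Lemma uniform_natE (p : pred nat) : uniform_nat [set w | p w]%classic =
  (#|[set i : 'I_N.+1 | p i]|%:R / N.+1%:R)%:E.
Proof.
rewrite /uniform_nat /mscale /msum [X in (_ * X)%E](_ : _ =
    \sum_(i < N.+1) (((i : nat) \in [set w | p w]%classic)%:R)%:E); last first.
  by apply: eq_bigr => i _; exact: diracE.
rewrite sumEFin -EFinM mulrC; congr ((_ / _)%:E).
rewrite -natr_sum; congr _%:R; rewrite -sum1_card [RHS]big_mkcond /=.
apply: eq_bigr => i _.
rewrite inE; case: ifPn => pi; first by rewrite mem_set.
by rewrite memNset //=; apply/negP.
Qed.

Lemma uniform_natT : uniform_nat [set: nat]%classic = 1%E.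
Proof.
have -> : [set: nat]%classic = [set w | xpredT w]%classic by apply/seteqP.
rewrite uniform_natE; have -> : [set i : 'I_N.+1 | xpredT i] = [set: 'I_N.+1].
  by apply/setP => i; rewrite !inE.
by rewrite cardsT card_ord divff // pnatr_eq0.
Qed.

HB.instance Definition _ :=
  Measure_isProbability.Build _ _ _ uniform_nat uniform_natT.

End UniformLaw.

(** * Random roots, and the analysis of the tester *)

Section Sampling.
Variables (n m : nat).

(** The coin is an index into the list of all functions from ['I_m] to ['I_n]: a uniform index
    yields [m] independent uniform vertices. The empty set is a default for indices past the end. *)
Definition sample (w : nat) : {set 'I_n} :=
  if onth (enum {ffun 'I_m -> 'I_n}) w is Some f then [set f j | j : 'I_m] else set0.

Lemma card_sample w : (#|sample w| <= m)%N.
Proof.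
rewrite /sample; case: onth => [f|]; last by rewrite cards0.
by apply: leq_trans (leq_imset_card _ _) _; rewrite card_ord.
Qed.

Lemma card_sample_miss (B : {set 'I_n}) : (0 < n)%N ->
  (#|[set i : 'I_(n ^ m).-1.+1 | [disjoint sample i & B]]| <= (n - #|B|) ^ m)%N.
Proof.
move=> n0; set E := enum {ffun 'I_m -> 'I_n}.
have sE : size E = (n ^ m).-1.+1.
  by rewrite -cardE card_ffun !card_ord prednK // expn_gt0 n0.
have -> : ((n - #|B|) ^ m)%N = #|ffun_on (mem (~: B)) : {pred {ffun 'I_m -> 'I_n}}|.
  rewrite card_ffun_on card_ord; congr (_ ^ _)%N.
  by have := cardsC B; rewrite card_ord => {1}<-; rewrite addKn.
pose f0 : {ffun 'I_m -> 'I_n} := [ffun=> Ordinal n0].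
pose F (i : 'I_(n ^ m).-1.+1) := nth f0 E i.
have Finj : injective F.
  move=> i j /eqP; rewrite nth_uniq ?sE ?enum_uniq // => /eqP; exact: val_inj.
rewrite -(card_imset _ Finj); apply: subset_leq_card.
apply/subsetP => _ /imsetP[i + ->]; rewrite inE.
rewrite /sample -/E; have -> : onth E i = Some (F i).
  by rewrite onthE (nth_map f0) // sE.
rewrite disjoint_subset => /subsetP h.
apply/ffun_onP => j; rewrite !inE; have := h (F i j); rewrite inE; apply.
exact: imset_f.
Qed.

End Sampling.

(** Multiplying the left side by $(1+e)^m$ gives $(1-e^2)^m \le 1$, and Bernoulli's inequality
    bounds $(1+e)^m$ below by $1+me$. *)
Lemma expr_1B_le (R : realType) (e : R) m :
  0 <= e <= 1 -> (1 - e) ^+ m <= (1 + m%:R * e)^-1.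
Proof.
move=> /andP[e0 e1].
have pos : 0 < 1 + m%:R * e by rewrite ltr_wpDr // mulr_ge0.
rewrite -[leRHS]mul1r ler_pdivlMr //.
apply: (@le_trans _ _ ((1 - e) ^+ m * (1 + e) ^+ m)).
  rewrite ler_wpM2l ?exprn_ge0 ?subr_ge0 //.
  elim: m {pos} => [|m IH]; first by rewrite mul0r addr0 expr0.
  rewrite exprS; have : 0 <= m%:R * e by rewrite mulr_ge0.
  have : (1 + e) * (1 + m%:R * e) <= (1 + e) * (1 + e) ^+ m by rewrite ler_wpM2l // addr_ge0.
  rewrite -natr1; nra.
rewrite -exprMn; apply: exprn_ile1; nra.
Qed.

(** On a far graph, $m\varepsilon \ge 2$ bounds the probability of missing all short cycles by
    $(1-\varepsilon)^m \le 1/3$. *)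
Theorem bfs_tester_correct (R : realType) (n d k m : nat) (eps : R) :
    (0 < n)%N -> 0 < eps <= 1 -> 2 <= m%:R * eps ->
  let A := bfs_tester d (uniform_nat R (n ^ m).-1) (@sample n m) (2 * k + 1) in
  round_adaptive_tester A k (k.+1 * (m * d.+1 ^ k.+1)) eps
    (@cycle_free (2 * k + 1) n) /\
  one_sided A k (@cycle_free (2 * k + 1) n).
Proof.
move=> n0 /andP[e0 e1] me A.
have complete : one_sided A k (@cycle_free (2 * k + 1) n).
  by move=> G g w gG free; exact: bfs_accepts gG free.
split=> //; split=> [G g w _|G g gG free|G g gG far].
- exact/num_queries_bfs/card_sample.
- have -> : [set w | accepts (A := A) k.+1 g w]%classic = [set: nat]%classic.
    by apply/seteqP; split=> // w _; exact: complete gG free.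
  by rewrite probability_setT lee_fin ler_pdivrMr // mul1r ler_nat.
pose B := on_short_cycle (2 * k + 1) G.
have Bn : eps < #|B|%:R / n%:R.
  by apply: (lt_le_trans far); exact: dist_le_on_short_cycle.
set N := (n ^ m).-1.
have -> : coin_law A [set w | ~~ accepts (A := A) k.+1 g w]%classic = _ :=
  uniform_natE R N (fun w => ~~ accepts (A := A) k.+1 g w).
rewrite lee_fin; set rej := [set i : 'I_N.+1 | _].
have NE : N.+1 = (n ^ m)%N by rewrite prednK // expn_gt0 n0.
have missE : ~: rej \subset [set i : 'I_N.+1 | [disjoint @sample n m i & B]].
  apply/subsetP => i; rewrite !inE negbK; apply: contraTT.
  move=> /pred0Pn[x /andP[/= xi]]; rewrite inE => /asboolP[c [cyc c3 xc]].
  have [c_ge c_le] := andP c3.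
  apply: (@bfs_rejects R n d (uniform_nat R N) (@sample n m) _ g G i k c gG cyc).
  - by rewrite c_ge; move: c_le; rewrite mul2n addn1.
  - exact: c_le.
  - by apply/hasP; exists x.
have card_rej : (N.+1 <= #|rej| + (n - #|B|) ^ m)%N.
  rewrite -{1}(card_ord N.+1) -(cardsC rej) leq_add2l.
  by apply: (leq_trans (subset_leq_card missE)); exact: card_sample_miss.
have n0R : 0 < n%:R :> R by rewrite ltr0n.
have nm0 : 0 < (n ^ m)%:R :> R by rewrite ltr0n expn_gt0 n0.
have Bln : (#|B| <= n)%N by rewrite -[leqRHS](card_ord n) max_card.
have miss : ((n - #|B|) ^ m)%:R <= 3^-1 * (n ^ m)%:R :> R.
  rewrite !natrX natrB // -ler_pdivrMr ?exprn_gt0 // -expr_div_n.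
  have -> : (n%:R - #|B|%:R) / n%:R = 1 - #|B|%:R / n%:R :> R.
    by rewrite mulrBl divff // gt_eqF.
  apply: (@le_trans _ _ ((1 - eps) ^+ m)).
    rewrite lerXn2r ?nnegrE ?subr_ge0 //; last by rewrite lerD2l lerN2 ltW.
    by rewrite ler_pdivrMr // mul1r ler_nat.
  apply: (le_trans (expr_1B_le _ _)); first by rewrite (ltW e0).
  by rewrite lef_pV2 ?posrE //; lra.
have : (N.+1)%:R <= (#|rej| + (n - #|B|) ^ m)%:R :> R by rewrite ler_nat.
have N0 : 0 < N.+1%:R :> R by rewrite ltr0n.
move: miss; rewrite -NE natrD ler_pdivlMr //; lra.
Qed.

(** * The hard distributions *)

Section Doubling.
Variable k : nat.
Local Notation Z := 'I_(4 * k).+2.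

Lemma val_succ (x : Z) :
  (x + 1 : Z) = (if x == (4 * k).+1 :> nat then 0 else x.+1) :> nat.
Proof.
have -> : (x + 1 : Z) = ((x + 1 %% (4 * k).+2) %% (4 * k).+2)%N :> nat by [].
rewrite modnDmr addn1; have xlt := ltn_ord x.
case: eqP => [->|ne]; first by rewrite modnn.
by rewrite modn_small //; lia.
Qed.

(** The signed residue of [x] modulo $4k+2$ lies in $[-l,l]$. *)
Definition near (l : nat) (x : Z) : bool := (x <= l)%N || ((4 * k).+2 <= x + l)%N.

Lemma near_succ l x : near l x -> near l.+1 (x + 1).
Proof.
by have := ltn_ord x; rewrite /near val_succ; case: eqP => _ *; apply/orP; lia.
Qed.

Lemma near_pred l x : near l x -> near l.+1 (x - 1).
Proof.
have pred_near y : near l (y + 1) -> near l.+1 y.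
  by have := ltn_ord y; rewrite /near val_succ; case: eqP => *; apply/orP; lia.
by move=> nx; apply: pred_near; rewrite subrK.
Qed.

(* In signed residues modulo [4k + 2], [u |-> 2u] on [[-k, k]] and
   [u + (2k + 1) |-> 2u + (2k + 1)] on the other half. *)
Definition dbl (x : Z) : Z :=
  inord (if (x <= k)%N then 2 * x else if (x <= 3 * k + 1)%N
         then 2 * x - (2 * k + 1) else 2 * x - (4 * k + 2))%N.

Lemma val_dbl x : dbl x =
  (if (x <= k)%N then 2 * x else if (x <= 3 * k + 1)%N
   then 2 * x - (2 * k + 1) else 2 * x - (4 * k + 2))%N :> nat.
Proof.
have xlt := ltn_ord x; rewrite /dbl inordK //.
by case: ifP => ?; [|case: ifP => ?]; lia.
Qed.

(** The half around 0 takes even values and the other half odd ones. *)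
Lemma dbl_inj : injective dbl.
Proof.
move=> x y /(congr1 val) /=; rewrite !val_dbl => e; apply: val_inj => /=.
have := ltn_ord x; have := ltn_ord y; move: e.
by do 2 (case: ifP => ?; [|case: ifP => ?]); lia.
Qed.

Lemma dbl0 : dbl 0 = 0.
Proof. by apply: val_inj; rewrite /= val_dbl. Qed.

(** Both ends must be near: [dbl] is multiplication by 2 on $[-k,k]$ but jumps on leaving this
    interval. *)
Lemma dbl_succ x : near k x -> near k (x + 1) -> dbl (x + 1) = dbl x + (1 + 1).
Proof.
suff dblE : near k x -> near k (x + 1) -> dbl (x + 1) = dbl x + 1 + 1 :> Z.
  by move=> nx ny; rewrite dblE // addrA.
rewrite /near => nx ny; apply: ord_inj; have xlt := ltn_ord x.
have := val_succ (dbl x + 1); have := val_succ (dbl x).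
have := val_dbl x; have := val_dbl (x + 1); move: ny (val_succ x).
by case: eqP => ? ?; do ?(case: ifP => ?); move=> *; lia.
Qed.

End Doubling.

(** * Randomly labelled unions of cycles *)

Section Places.
Variables (k M r : nat).
Local Notation Z := 'I_(4 * k).+2.

(* The [r] places outside the blobs are isolated; they absorb [n mod (4k + 2)]. *)
Definition place : finType := ('I_M * Z + 'I_r)%type.

Definition blob (v : place) : option 'I_M := if v is inl (i, _) then Some i else None.

Definition offset (v : place) : Z := if v is inl (_, u) then u else 0.

Definition shift (e : Z) (v : place) : place :=
  match v with inl (i, u) => inl (i, u + e) | inr j => inr j end.

Lemma shiftK e : cancel (shift e) (shift (- e)).
Proof. by case=> [[i u]|j] //=; rewrite addrK. Qed.

Lemma shiftNK e : cancel (shift (- e)) (shift e).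
Proof. by case=> [[i u]|j] //=; rewrite subrK. Qed.

Lemma blob_shift e v : blob (shift e v) = blob v.
Proof. by case: v => [[]|]. Qed.

Variables (n d : nat) (f : 'I_n -> place) (f' : place -> 'I_n).
Hypotheses (fK : cancel f f') (f'K : cancel f' f).
Implicit Types (s : {perm 'I_n}) (e : Z).

Definition pos s (x : 'I_n) : place := f (s x).
Definition lab s (v : place) : 'I_n := (s^-1)%g (f' v).

Lemma posK s : cancel (pos s) (lab s).
Proof. by move=> x; rewrite /lab /pos fK permK. Qed.

Lemma labK s : cancel (lab s) (pos s).
Proof. by move=> v; rewrite /lab /pos permKV f'K. Qed.

Lemma pos_inj s : injective (pos s).
Proof. exact: can_inj (posK s). Qed.

(** For $k \ge 1$, [e = 1] makes each blob one $(4k+2)$-cycle and [e = 1 + 1] makes it two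
    $(2k+1)$-cycles. The forward neighbour is always listed first, so that the coupling also
    preserves port numbers. *)
Definition row e s (x : 'I_n) : seq 'I_n :=
  if blob (pos s x) is Some _ then
    [:: lab s (shift e (pos s x)); lab s (shift (- e) (pos s x))] else [::].

Lemma mem_row e s x y : (y \in row e s x) = (blob (pos s x) != None) &&
  ((pos s y == shift e (pos s x)) || (pos s y == shift (- e) (pos s x))).
Proof.
rewrite /row; case: (blob _) => [i|] //=; rewrite !inE.
by rewrite -!(can2_eq (posK s) (labK s)).
Qed.

Definition blob_adj e s : adjlist n d := [ffun xi : 'I_n * 'I_d => onth (row e s xi.1) xi.2].

Definition blob_rel e s : rel 'I_n := fun x y => y \in row e s x.

Lemma blob_sym e s : symmetric (blob_rel e s).
Proof.
have half x y : blob_rel e s x y -> blob_rel e s y x.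
  rewrite /blob_rel !mem_row => /andP[bx /orP[]/eqP->]; rewrite blob_shift bx /=.
    by rewrite shiftK eqxx orbT.
  by rewrite shiftNK eqxx.
by move=> x y; apply/idP/idP; apply: half.
Qed.

Lemma shift_neq e v : e != 0 -> blob v != None -> shift e v != v.
Proof.
case: v => [[i u]|] //= e0 _; apply: contra e0 => /eqP[].
by move/eqP; rewrite -subr_eq0 addrC addKr.
Qed.

(** The condition on [e] excludes loops here, and keeps the two entries of a row distinct in
    [blob_represents]. *)
Lemma blob_irr e s : e + e != 0 -> irreflexive (blob_rel e s).
Proof.
move=> ee x; have e0 : e != 0 by apply: contra ee => /eqP->; rewrite addr0.
apply/negbTE; rewrite /blob_rel mem_row.
case bx: (blob _ != None) => //=; rewrite ![pos s x == _]eq_sym.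
by rewrite !(negPf (shift_neq _ bx)) ?oppr_eq0.
Qed.

Definition blob_graph e s (ee : e + e != 0) : graph n := Graph (blob_sym e s) (blob_irr s ee).

Lemma blob_represents e s (ee : e + e != 0) : (2 <= d)%N ->
  represents (blob_adj e s) (blob_graph s ee).
Proof.
move=> d2 x; exists (row e s x); split=> //.
- have := @shift_neq (e + e) (shift (- e) (pos s x)) ee; rewrite blob_shift /row.
  case: (pos s x) => [[i u]|] //= /(_ isT); rewrite addrA subrK inE andbT.
  by rewrite (can_eq (labK s)).
- by apply: leq_trans d2; rewrite /row; case: blob.
- by move=> i; rewrite ffunE.
Qed.

(** Otherwise two steps forward from [x] would return to [x], but in [x :: y :: z :: c'] they lead
    to [z]. *)
Lemma next_neq_prev (T : eqType) (c : seq T) x :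
  uniq c -> (3 <= size c)%N -> x \in c -> next c x != prev c x.
Proof.
move=> uc c3 xc; have [i c' rot_c] := rot_to xc.
have uc' : uniq (x :: c') by rewrite -rot_c rot_uniq.
have c3' : (3 <= size (x :: c'))%N by rewrite -rot_c size_rot.
apply/eqP => np; have := next_prev uc x; rewrite -np -!(next_rot i uc) rot_c.
case: c' uc' c3' {rot_c} => [|y [|z c']] //= uc' _; rewrite eqxx.
move: uc'; rewrite !inE !negb_or => /and3P[/and3P[xy xz _] /andP[yz _] _].
by rewrite eq_sym (negPf xy) /= eqxx => zx; rewrite zx eqxx in xz.
Qed.

(** The two distinct cycle neighbours of a vertex exhaust its row, so the cycle is closed under the
    shift by 1 and contains a whole blob. *)
Lemma unit_cycle_size s (ee : (1 : Z) + 1 != 0) (c : seq 'I_n) :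
  ucycle (blob_graph s ee) c -> (3 <= size c)%N -> ((4 * k).+2 <= size c)%N.
Proof.
move=> /andP[cyc uc] c3.
have step x : x \in c -> lab s (shift 1 (pos s x)) \in c.
  move=> xc; have := next_neq_prev uc c3 xc.
  have := next_cycle cyc xc; have := prev_cycle cyc xc.
  rewrite edge_sym /= /blob_rel !mem_row => /andP[_ hp] /andP[_ hn] np.
  have [/eqP<-|/negPf ne1] := boolP (pos s (next c x) == shift 1 (pos s x)).
    by rewrite posK mem_next.
  have [/eqP<-|/negPf ne2] := boolP (pos s (prev c x) == shift 1 (pos s x)).
    by rewrite posK mem_prev.
  move: hp hn; rewrite ne1 ne2 /= => /eqP hp /eqP hn.
  by rewrite -hp in hn; rewrite (pos_inj hn) eqxx in np.
have [x xc] : exists x, x \in c by case: c c3 {cyc uc step} => // x c _; exists x; rewrite inE eqxx.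
have [i [u xE]] : exists i u, pos s x = inl (i, u).
  have := next_cycle cyc xc; rewrite /= /blob_rel mem_row => /andP[+ _].
  by case: (pos s x) => [[i u]|] // _; exists i, u.
have all_c (m : nat) : lab s (inl (i, u + m%:R)) \in c.
  elim: m => [|m IH]; first by rewrite addr0 -xE posK.
  by have := step _ IH; rewrite labK /= -natr1 addrA.
rewrite -(card_ord (4 * k).+2) -(card_codom (f := fun w : Z => lab s (inl (i, u + w)))).
  apply: leq_trans (card_size c); apply: subset_leq_card.
  by apply/subsetP => _ /codomP[w ->]; rewrite -(natr_Zp w).
by move=> w w' /(can_inj (labK s)) /(congr1 offset); apply: addrI.
Qed.

Definition double_step_cycle s (i : 'I_M) : seq 'I_n :=
  [seq lab s (inl (i, (j * 2)%N%:R)) | j <- iota 0 (2 * k + 1)%N].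

(** Any relation containing the edges of this one blob is allowed, so that a modified graph that
    left the blob intact is covered. *)
Lemma double_step_ucycle s (i : 'I_M) (G : rel 'I_n) :
  (forall x y : 'I_n, blob (pos s x) = Some i -> y \in row (1 + 1) s x -> G x y) ->
  ucycle G (double_step_cycle s i).
Proof.
move=> sub; apply/andP; split; last first.
  rewrite map_inj_in_uniq ?iota_uniq // => j j'; rewrite !mem_iota => jk jk'.
  move=> /(can_inj (labK s)) /(congr1 offset) /=; rewrite !Zp_nat => /(congr1 val) /=.
  by rewrite !modn_small; lia.
pose F j := lab s (inl (i, (j * 2)%N%:R)).
have step j : G (F j) (F j.+1).
  apply: sub; first by rewrite labK.
  rewrite mem_row !labK /=; apply/orP; left; apply/eqP; congr (inl (_, _)).
  have -> : (j.+1 * 2 = j * 2 + 2)%N by lia.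
  exact: (mulrnDr (1 : Z) (j * 2) 2).
have steps m : forall j, path G (F j) (map F (iota j.+1 m)).
  by elim: m => //= m IH j; rewrite step IH.
rewrite /double_step_cycle addn1 -/F.
have -> : cycle G (map F (iota 0 (2 * k).+1)) =
  path G (F 0) (rcons (map F (iota 1 (2 * k))) (F 0)) by [].
have ends m : forall j, last (F j) (map F (iota j.+1 m)) = F (j + m)%N.
  by elim: m => /= [|m IH] j; rewrite ?addn0 // IH addnS.
rewrite rcons_path steps ends add0n /=.
(* The closing edge: $2(2k+1)$ is 0 modulo $4k+2$. *)
suff -> : F 0 = F (2 * k).+1 by [].
congr (lab _ (inl (_, _))); rewrite !Zp_nat; apply: val_inj => /=.
have -> : ((2 * k).+1 * 2 = (4 * k).+2)%N by lia.
by rewrite modnn mul0n.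
Qed.

End Places.

(** * Counting permutations *)

Section Counting.
Local Open Scope nat_scope.

Lemma card_sum_pred (T : finType) (P : pred T) : #|[set s | P s]| = \sum_s P s.
Proof.
rewrite -sum1_card big_mkcond /=; apply: eq_bigr => s _.
by rewrite inE; case: (P s).
Qed.

Lemma exists_le_sum (T : finType) (P : pred T) : [exists i, P i] <= \sum_i P i.
Proof.
by case: existsP => // -[i Pi]; rewrite (bigD1 i) //= Pi leq_addr.
Qed.

Lemma card_bigcup_le (I T : finType) (P : pred I) (F : I -> {set T}) :
  #|\bigcup_(i | P i) F i| <= \sum_(i | P i) #|F i|.
Proof.
elim/big_rec2: _ => [|i m S _ IH]; first by rewrite cards0.
by apply: leq_trans (leq_card_setU _ _) _; rewrite leq_add2l.
Qed.

(* Where a permutation sends the point [x] is still uniform outside [W s] once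
   [W s] has been revealed: exchange [x] with any other unrevealed point. *)
Lemma swap_count (T : finType) (x : T) (F : pred {perm T})
    (W : {perm T} -> {set T}) (hit : {perm T} -> pred T) (kappa delta : nat) :
  (forall s z, F s -> z \notin W s ->
     [/\ F (tperm x z * s)%g, W (tperm x z * s)%g = W s
       & hit (tperm x z * s)%g z = hit s x]) ->
  (forall s, F s -> #|W s| <= kappa) ->
  (forall s, F s -> #|[set z | hit s z]| <= delta) ->
  #|[set s | F s && hit s x]| * (#|T| - kappa) <= #|[set s | F s]| * delta.
Proof.
move=> swap Wk hitd.
rewrite -!sum_nat_const.
apply: (@leq_trans (\sum_(s in [set s | F s && hit s x]) \sum_z (z \notin W s))).
  apply: leq_sum => s; rewrite inE => /andP[Fs _].
  rewrite -card_sum_pred; have := cardsC (W s).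
  have -> : [set z | z \notin W s] = ~: W s by apply/setP => z; rewrite !inE.
  have := Wk _ Fs; lia.
apply: (@leq_trans (\sum_z #|[set s | F s && hit s z]|)).
  rewrite exchange_big; apply: leq_sum => z _.
  rewrite -big_mkcondr /= sum1_card.
  (* Left multiplication by [tperm x z] carries a hit at [x] to a hit at [z], injectively. *)
  rewrite -(card_imset _ (mulgI (tperm x z))); apply: subset_leq_card.
  apply/subsetP => _ /imsetP[s + ->]; rewrite inE unfold_in inE => /andP[/andP[Fs hs] zW].
  by have [-> _ ->] := swap s z Fs zW; rewrite hs.
under eq_bigr do rewrite card_sum_pred.
rewrite exchange_big [X in _ <= X]big_mkcond /=; apply: leq_sum => s _.
rewrite inE; case: ifPn => Fs; last by rewrite big1.
by rewrite -card_sum_pred; exact: hitd.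
Qed.

End Counting.

(** * Runs on the hard graphs and the birthday bound *)

Section Runs.
Variables (R : realType) (k M r n d : nat).
Variables (f : 'I_n -> place k M r) (f' : place k M r -> 'I_n).
Hypotheses (fK : cancel f f') (f'K : cancel f' f).
Variables (A : algorithm R n d) (w : coins A).
Local Notation Z := 'I_(4 * k).+2.
Implicit Types (s : {perm 'I_n}) (e : Z).
Local Notation pos := (pos f).
Local Notation lab := (lab f').
Local Notation row := (row f f').

Definition run e s l := history (blob_adj d f f' e s) w l.
Definition queried e s l : {set 'I_n} := [set x.1 | x in queries w (run e s l)].
Definition nbhd e s x : {set 'I_n} :=
  [set x; lab s (shift e (pos s x)); lab s (shift (- e) (pos s x))].
(* Both neighbours of a queried vertex count as explored, even if only one of
   its two ports was queried: a fresh query is then independent of the history. *)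
Definition explored e s l : {set 'I_n} :=
  \bigcup_(j < l) \bigcup_(x in queried e s j) nbhd e s x.
Definition fresh e s l : {set 'I_n} := queried e s l :\: explored e s l.

(** The queries of a round depend only on earlier views, so equal rows at queried vertices keep the
    runs equal. Swapping labels uses this with [e' = e], the coupling with [e' = 1 + 1]. *)
Lemma run_eq e s e' s' l :
  (forall j x, (j < l)%N -> x \in queried e s j -> row e' s' x = row e s x) ->
  forall j, (j <= l)%N -> run e' s' j = run e s j.
Proof.
move=> rowE; elim=> // j IH jl; rewrite /run /= -/(run e' s' j) -/(run e s j).
rewrite IH 1?ltnW //; congr rcons; apply/ffunP => -[x i]; rewrite !ffunE.
case: ifP => // xq; rewrite /= (rowE j) //.
by apply/imsetP; exists (x, i).
Qed.

Lemma explored_eq e s e' s' l :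
  (forall j x, (j < l)%N -> x \in queried e s j ->
    row e' s' x = row e s x /\ nbhd e' s' x = nbhd e s x) ->
  explored e' s' l = explored e s l.
Proof.
move=> sameE; apply: eq_bigr => j _.
rewrite /queried (@run_eq e s e' s' l) //; last exact: ltnW (ltn_ord j).
  by apply: eq_bigr => x xq; have [] := sameE j x (ltn_ord j) xq.
by move=> i x il xq; have [] := sameE i x il xq.
Qed.

Lemma lab_agree s s' v : s' (lab s v) = s (lab s v) -> lab s' v = lab s v.
Proof.
move=> e; apply: (@pos_inj _ _ _ _ f f' fK s').
by rewrite (labK f'K) /pos e -[f _]/(pos s (lab s v)) (labK f'K).
Qed.

Lemma nbhd_agree e s s' x : {in nbhd e s x, s' =1 s} ->
  row e s' x = row e s x /\ nbhd e s' x = nbhd e s x.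
Proof.
move=> agree; have sx : s' x = s x by apply: agree; rewrite !inE eqxx.
have px : pos s' x = pos s x by rewrite /pos sx.
have l1 : lab s' (shift e (pos s x)) = lab s (shift e (pos s x)).
  by apply/lab_agree/agree; rewrite !inE eqxx !orbT.
have l2 : lab s' (shift (- e) (pos s x)) = lab s (shift (- e) (pos s x)).
  by apply/lab_agree/agree; rewrite !inE eqxx !orbT.
by rewrite /row /nbhd px l1 l2.
Qed.

(** The first [l] rounds depend on the labelling only through its values on the explored set. *)
Lemma explored_agree e s s' l : {in explored e s l, s' =1 s} ->
  queried e s' l = queried e s l /\ explored e s' l = explored e s l.
Proof.
move=> agree.
have sameE j x : (j < l)%N -> x \in queried e s j ->
    row e s' x = row e s x /\ nbhd e s' x = nbhd e s x.
  move=> jl xq; apply: nbhd_agree => y yx; apply: agree.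
  by apply/bigcupP; exists (Ordinal jl) => //; apply/bigcupP; exists x.
split; last exact: explored_eq.
rewrite /queried (@run_eq e s e s' l) //.
by move=> j x jl xq; have [] := sameE j x jl xq.
Qed.

(** The other queries of round [l] are included, so that two simultaneous entries into one blob
    collide as well. *)
Definition revealed e s l x : {set 'I_n} := explored e s l :|: (queried e s l :\ x).

Definition touches s (W : {set 'I_n}) x : bool :=
  [exists y in W, (blob (pos s y) != None) && (blob (pos s x) == blob (pos s y))].

Definition collision e s : bool :=
  [exists l : 'I_k, exists x, (x \in fresh e s l) && touches s (revealed e s l x) x].

Lemma card_touches s W : (#|[set x | touches s W x]| <= #|W| * (4 * k).+2)%N.
Proof.
pose B y : {set 'I_n} := if blob (pos s y) is Some i
  then [set lab s (inl (i, u)) | u : Z] else set0.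
have sub : [set x | touches s W x] \subset \bigcup_(y in W) B y.
  apply/subsetP => x; rewrite inE => /existsP[y /and3P[yW ny /eqP xy]].
  apply/bigcupP; exists y => //; rewrite /B -xy.
  case xE : (pos s x) ny => [[i u]|j]; last by rewrite -xy xE.
  by move=> _ /=; apply/imsetP; exists u; rewrite // -xE (posK fK).
apply: leq_trans (subset_leq_card sub) _.
apply: leq_trans (card_bigcup_le _ _) _.
rewrite -sum_nat_const; apply: leq_sum => y _; rewrite /B.
case: (blob _) => [i|]; last by rewrite cards0.
by apply: leq_trans (leq_imset_card _ _) _; rewrite card_ord.
Qed.

Variables (q : nat) (e : Z).
Hypothesis query_bound : forall s, (num_queries k (blob_adj d f f' e s) w <= q)%N.

Lemma sum_queried s : (\sum_(j < k) #|queried e s j| <= q)%N.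
Proof.
apply: leq_trans (query_bound s); apply: leq_sum => j _.
exact: leq_imset_card.
Qed.

Lemma card_revealed s (l : 'I_k) x : (#|revealed e s l x| <= 3 * q)%N.
Proof.
apply: (@leq_trans (3 * \sum_(j < k) #|queried e s j|)); last first.
  by rewrite leq_mul2l sum_queried.
have -> : (\sum_(j < k) #|queried e s j| = \sum_(0 <= j < k) #|queried e s j|)%N.
  by rewrite big_mkord.
(* Rounds after [l] are dropped. Each vertex queried before [l] reveals at most three vertices, and
   each one queried in round [l] only itself. *)
rewrite (big_cat_nat (n := l.+1)) //=; apply: leq_trans (leq_mul (leqnn 3) (leq_addr _ _)).
rewrite big_nat_recr //= mulnDr; apply: leq_trans (leq_card_setU _ _) _.
apply: leq_add; last first.
  by apply: (@leq_trans #|queried e s l|); [exact: subset_leq_card (subsetDl _ _)|exact: leq_pmull].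
rewrite big_mkord big_distrr; apply: leq_trans (card_bigcup_le _ _) _.
apply: leq_sum => j _; apply: leq_trans (card_bigcup_le _ _) _.
apply: (@leq_trans (\sum_(y in queried e s j) 3)).
  apply: leq_sum => y _.
  by rewrite (leq_trans (leq_card_setU _ _)) // cards1 addn1 ltnS cards2; case: eqP.
by rewrite sum_nat_const mulnC.
Qed.

(** By [swap_count] a fresh vertex is as likely to be at any unrevealed place, and at most [3 * q]
    blobs are spoiled. Summing over at most [q] fresh queries in each of [k] rounds gives density
    $O(q^2/n)$. *)
Lemma card_collision :
  (#|[set s | collision e s]| * (n - 3 * q) <=
     k * (#|{perm 'I_n}| * q) * (3 * q * (4 * k).+2))%N.
Proof.
set delta := (3 * q * (4 * k).+2)%N.
have one (l : 'I_k) x :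
  (#|[set s | (x \in fresh e s l) && touches s (revealed e s l x) x]| * (n - 3 * q) <=
     #|[set s | x \in fresh e s l]| * delta)%N.
  have -> : (n - 3 * q = #|'I_n| - 3 * q)%N by rewrite card_ord.
  apply: (@swap_count _ x (fun s => x \in fresh e s l)
    (fun s => revealed e s l x) (fun s => touches s (revealed e s l x))).
  - move=> s z; rewrite [x \in _]inE => /andP[xK xq].
    set s' := (tperm x z * s)%g; rewrite inE negb_or => /andP[zK zq].
    (* As [x] is fresh and [z] unrevealed, exchanging them moves nothing revealed, so the run up to
       round [l] is unchanged. *)
    have s'E y : y \in revealed e s l x -> s' y = s y.
      move=> yW; rewrite permM tpermD //; last first.
        by apply: contraTneq yW => <-; rewrite inE negb_or zK.
      by apply: contraTneq yW => <-; rewrite !inE eqxx /= orbF.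
    have [qE KE] : queried e s' l = queried e s l /\ explored e s' l = explored e s l.
      by apply: explored_agree => y yK; apply: s'E; rewrite inE yK.
    have WE : revealed e s' l x = revealed e s l x by rewrite /revealed qE KE.
    split=> //; first by rewrite /fresh qE KE inE xK.
    rewrite /touches WE; apply: eq_existsb => y.
    have [yW|//] := boolP (y \in revealed e s l x).
    by rewrite /pos s'E // /s' permM tpermR.
  - by move=> s _; exact: card_revealed.
  - move=> s _; apply: leq_trans (card_touches _ _) _.
    by rewrite leq_mul2r card_revealed orbT.
have sum_l (l : 'I_k) : (\sum_x #|[set s | x \in fresh e s l]| <= #|{perm 'I_n}| * q)%N.
  under eq_bigr do rewrite card_sum_pred.
  rewrite exchange_big -sum_nat_const; apply: leq_sum => s _.
  rewrite -card_sum_pred; apply: leq_trans (sum_queried s).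
  rewrite (bigD1 l) //=; apply: leq_trans (leq_addr _ _).
  by apply: subset_leq_card; apply/subsetP => x; rewrite !inE => /andP[].
apply: (@leq_trans (\sum_(l < k) \sum_x
  #|[set s | (x \in fresh e s l) && touches s (revealed e s l x) x]| * (n - 3 * q))).
  under [X in (_ <= X)%N]eq_bigr do rewrite -big_distrl /=.
  rewrite -big_distrl leq_mul2r; apply/orP; right.
  under [X in (_ <= X)%N]eq_bigr do under eq_bigr do rewrite card_sum_pred.
  under [X in (_ <= X)%N]eq_bigr do rewrite exchange_big.
  rewrite exchange_big card_sum_pred; apply: leq_sum => s _.
  apply: leq_trans (exists_le_sum _) _; apply: leq_sum => l _; exact: exists_le_sum.
apply: (@leq_trans (\sum_(l < k) #|{perm 'I_n}| * q * delta)); last first.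
  by rewrite sum_nat_const card_ord mulnA.
apply: leq_sum => l _; apply: leq_trans (leq_sum _ (fun x _ => one l x)) _.
by rewrite -big_distrl leq_mul2r sum_l orbT.
Qed.

End Runs.

(** * The coupling of collision-free labellings *)

Section Coupling.
Variables (R : realType) (k M r n d : nat).
Variables (f : 'I_n -> place k M r) (f' : place k M r -> 'I_n).
Hypotheses (fK : cancel f f') (f'K : cancel f' f).
Variables (A : algorithm R n d) (w : coins A).
Local Notation Z := 'I_(4 * k).+2.
Implicit Types (s : {perm 'I_n}) (e : Z) (o : 'I_M -> Z).
Local Notation pos := (pos f).
Local Notation lab := (lab f').
Local Notation row := (row f f').
Local Notation run := (run f f' w).
Local Notation queried := (queried f f' w).
Local Notation nbhd := (nbhd f f').
Local Notation explored := (explored f f' w).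
Local Notation fresh := (fresh f f' w).
Local Notation collision := (collision f f' w).

Definition entry_points e s : {set 'I_n} := \bigcup_(l < k) fresh e s l.

(* Without a collision every queried blob has exactly one entry point, whose
   offset is its origin; for the other blobs the value 0 is immaterial. *)
Definition origin e s (i : 'I_M) : Z :=
  if [pick x in entry_points e s | blob (pos s x) == Some i] is Some x
  then offset (pos s x) else 0.

(** Of two entry points in one blob, the later one would collide with the earlier, and in the same
    round each with the other. *)
Lemma entry_unique e s x y i : ~~ collision e s ->
  x \in entry_points e s -> y \in entry_points e s ->
  blob (pos s x) = Some i -> blob (pos s y) = Some i -> x = y.
Proof.
move=> ncol /bigcupP[l _ xl] /bigcupP[l' _ yl'].
wlog ll : x y l l' xl yl' / (l <= l')%N.
  move=> th; have [ll|/ltnW ll] := leqP l l'; first exact: th ll.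
  by move=> bx bY; apply/esym; apply: th ll bY bx.
move=> bx bY; apply/eqP/negPn; apply: contra ncol => xy.
apply/existsP; exists l'; apply/existsP; exists y; rewrite yl' /=.
apply/existsP; exists x; rewrite bx bY eqxx !andbT.
move: xl; rewrite in_setD => /andP[_ xl].
move: ll; rewrite leq_eqVlt => /orP[/eqP/val_inj ll|ll]; rewrite inE.
  by rewrite -ll in_setD1 xl xy orbT.
apply/orP; left; apply/bigcupP; exists (Ordinal ll) => //.
by apply/bigcupP; exists x => //; rewrite !inE eqxx.
Qed.

Lemma near_le l l' (u : Z) : (l <= l')%N -> near l u -> near l' u.
Proof. by rewrite /near => ll; lia. Qed.

(** Induction on the round: a vertex that is not fresh equals or neighbours one queried strictly
    earlier, so each round adds at most one step. *)
Lemma queried_near_entry s l x i : (l < k)%N -> x \in queried 1 s l ->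
  blob (pos s x) = Some i ->
  exists y, [/\ y \in entry_points 1 s, blob (pos s y) = Some i
              & near l (offset (pos s x) - offset (pos s y))].
Proof.
elim/ltn_ind: l x => l IH x lk xl bx.
have [/bigcupP[j _ /bigcupP[y yj xy]]|xK] := boolP (x \in explored 1 s l); last first.
  exists x; split=> //; last by rewrite subrr.
  by apply/bigcupP; exists (Ordinal lk) => //; rewrite in_setD xK.
have jl := ltn_ord j.
have bY : blob (pos s y) = Some i.
  by move: xy bx; rewrite !inE => /orP[/orP[]|] /eqP->; rewrite ?(labK f'K) ?blob_shift.
have [z [zE bz nz]] := IH j jl y (ltn_trans jl lk) yj bY.
exists z; split=> //; apply: (near_le jl).
have offE e : offset (shift e (pos s y)) = offset (pos s y) + e.
  by case: (pos s y) bY => [[]|].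
move: xy; rewrite !inE => /orP[/orP[]|] /eqP->; rewrite ?(labK f'K) ?offE.
- exact: near_le nz.
- by rewrite addrAC; apply: near_succ.
- by rewrite addrAC; apply: near_pred.
Qed.

Lemma queried_near s l x i u : ~~ collision 1 s -> (l < k)%N ->
  x \in queried 1 s l -> pos s x = inl (i, u) -> near l (u - origin 1 s i).
Proof.
move=> ncol lk xl xE; have bx : blob (pos s x) = Some i by rewrite xE.
have [y [yE bY]] := queried_near_entry lk xl bx; rewrite xE /origin.
case: pickP => [z /andP[zE /eqP bz]|/(_ y)]; last by rewrite yE bY eqxx.
by rewrite (entry_unique ncol zE yE bz bY).
Qed.

Definition twist o (v : place k M r) : place k M r :=
  if v is inl (i, u) then inl (i, o i + dbl (u - o i)) else v.

Lemma blob_twist o v : blob (twist o v) = blob v.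
Proof. by case: v => [[]|]. Qed.

Lemma twist_inj o : injective (twist o).
Proof.
move=> [[i u]|j] [[i' u']|j'] // e.
have ii : i = i' by have := congr1 (@blob k M r) e; case.
rewrite -ii in e *; congr (inl (_, _)).
by move/(congr1 (@offset k M r)): e => /= /addrI /dbl_inj /addIr.
Qed.

Lemma twisted_inj o s : injective (fun x => f' (twist o (pos s x))).
Proof. by move=> x y /(can_inj f'K) /twist_inj /(pos_inj fK). Qed.

Definition twisted o s : {perm 'I_n} := perm (@twisted_inj o s).

Lemma pos_twisted o s x : pos (twisted o s) x = twist o (pos s x).
Proof. by rewrite /pos permE f'K. Qed.

(** The strict bound on [l] leaves room for one more step: neighbours are still within [k], where
    [dbl] is doubling. *)
Definition in_reach o (v : place k M r) : Prop :=
  if v is inl (i, u) then exists2 l, (l < k)%N & near l (u - o i) else True.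

Lemma twist_shift o v : in_reach o v ->
  twist o (shift 1 v) = shift (1 + 1) (twist o v) /\
  twist o (shift (- 1) v) = shift (- (1 + 1)) (twist o v).
Proof.
case: v => [[i u] [l lk nu]|] //.
have step t : near k (t - o i) -> near k (t + 1 - o i) ->
    twist o (inl (i, t + 1)) = shift (1 + 1) (twist o (inl (i, t))).
  rewrite addrAC => n0 n1; rewrite /twist /shift; congr (inl (_, _)).
  by rewrite [t + 1 - o i]addrAC dbl_succ // addrA.
have nk : near k (u - o i) := near_le (ltnW lk) nu.
split; first by apply: step => //; rewrite addrAC; apply: near_le lk (near_succ nu).
(* The backward case is the forward step taken from [u - 1]. *)
apply: (can_inj (@shiftK k M r (1 + 1))); rewrite shiftNK.
rewrite -[shift (- 1) _]/(inl (i, u - 1)) -step ?subrK //.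
by rewrite addrAC; apply: near_le lk (near_pred nu).
Qed.

Lemma row_twisted o s x : in_reach o (pos s x) ->
  row (1 + 1) (twisted o s) x = row 1 s x /\
  nbhd (1 + 1) (twisted o s) x = nbhd 1 s x.
Proof.
move=> /twist_shift[sh1 sh2].
have labE v : lab (twisted o s) (twist o v) = lab s v.
  by rewrite -{1}(labK f'K s v) -pos_twisted (posK fK).
by rewrite /row /nbhd pos_twisted blob_twist -sh1 -sh2 !labE.
Qed.

(** The second claim lets the origins be read off the twisted labelling, so that the twist can be
    undone. *)
Lemma coupled_runs s : ~~ collision 1 s ->
  run (1 + 1) (twisted (origin 1 s) s) k = run 1 s k /\
  origin (1 + 1) (twisted (origin 1 s) s) =1 origin 1 s.
Proof.
move=> ncol; set s' := twisted _ s.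
have sameE j x : (j < k)%N -> x \in queried 1 s j ->
    row (1 + 1) s' x = row 1 s x /\ nbhd (1 + 1) s' x = nbhd 1 s x.
  move=> jk xj; apply: row_twisted; case xE: (pos s x) => [[i u]|] //=.
  by exists j; last exact: queried_near xE.
have runE j : (j <= k)%N -> run (1 + 1) s' j = run 1 s j.
  by apply: run_eq => i x ik xi; have [] := sameE i x ik xi.
split; first exact: runE.
have entryE : entry_points (1 + 1) s' = entry_points 1 s.
  apply: eq_bigr => l _; rewrite /fresh /queried runE; last exact: ltnW (ltn_ord l).
  congr (_ :\: _); apply: explored_eq => j x jl; apply: sameE.
  exact: ltn_trans jl (ltn_ord l).
move=> i; rewrite [LHS]/origin.
have -> : [pick x in entry_points (1 + 1) s' | blob (pos s' x) == Some i] =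
    [pick x in entry_points 1 s | blob (pos s x) == Some i].
  by apply: eq_pick => x; rewrite entryE pos_twisted blob_twist.
rewrite [RHS]/origin; case: pickP => // x /andP[xE /eqP bx].
rewrite pos_twisted; case xP: (pos s x) bx => [[i' u]|] //= [ii]; rewrite {}ii in xP *.
(* The entry point is itself the origin of its blob, and the twist fixes origins because
   [dbl 0 = 0]. *)
suff -> : origin 1 s i = u by rewrite subrr dbl0 addr0.
rewrite /origin; case: pickP => [y /andP[yE /eqP bY]|/(_ x)].
  by rewrite (entry_unique (i := i) ncol yE xE bY) ?xP.
by rewrite xE xP eqxx.
Qed.

Lemma accept_coupling :
  (#|[set s | accepts k (blob_adj d f f' 1%R s) w]| <=
   #|[set s | accepts k (blob_adj d f f' (1 + 1)%R s) w]| +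
   #|[set s | collision 1%R s]|)%N.
Proof.
pose a e := [set s | accepts k (blob_adj d f f' e s) w].
rewrite -/(a 1) -/(a (1 + 1)) -(cardsID [set s | collision 1 s] (a 1)) addnC.
apply: leq_add; last exact: subset_leq_card (subsetIr _ _).
rewrite -(@card_in_imset _ _ (fun s => twisted (origin 1 s) s)); last first.
  move=> s s'; rewrite !inE => /andP[ns _] /andP[ns' _] e.
  (* Equal images have equal origins, hence come from one and the same injective twist. *)
  have oE : origin 1 s =1 origin 1 s'.
    move=> i; rewrite -(proj2 (coupled_runs ns)) e; exact: (proj2 (coupled_runs ns')).
  apply/permP => x; apply: (can_inj fK); apply: (@twist_inj (origin 1 s)).
  rewrite -[f (s x)]/(pos s x) -[f (s' x)]/(pos s' x) -pos_twisted e pos_twisted.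
  by case: (pos s' x) => [[i u]|] //=; rewrite oE.
apply: subset_leq_card; apply/subsetP => _ /imsetP[s + ->].
rewrite !inE => /andP[ns]; rewrite /accepts.
by have [+ _] := coupled_runs ns; rewrite /run => ->.
Qed.

End Coupling.

(** * The lower bound *)

Section LowerDistance.
Variables (R : realType) (k M r n d : nat).
Variables (f : 'I_n -> place k M r) (f' : place k M r -> 'I_n).
Hypotheses (fK : cancel f f') (f'K : cancel f' f).
Hypotheses (k_gt0 : (1 <= k)%N) (d_ge2 : (2 <= d)%N).

(** A blob without a changed entry would keep its $(2k+1)$-cycles. Changes in different blobs are
    different entries. *)
Lemma changes_ge_blobs (s : {perm 'I_n}) (g : adjlist n d) (G : graph n) :
  represents g G -> cycle_free (2 * k + 1) G ->
  (M <= #|[pred x | blob_adj d f f' (1 + 1)%R s x != g x]|)%N.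
Proof.
move=> gG free.
have changed (i : 'I_M) : exists x : 'I_n * 'I_d,
    blob (pos f s x.1) = Some i /\ blob_adj d f f' (1 + 1)%R s x != g x.
  have [//|none] := pselect (exists x : 'I_n * 'I_d,
    blob (pos f s x.1) = Some i /\ blob_adj d f f' (1 + 1)%R s x != g x).
  suff cyc : ucycle G (double_step_cycle f' s i).
    have sizeE : size (double_step_cycle f' s i) = (2 * k + 1)%N.
      by rewrite size_map size_iota.
    have := free _ cyc; rewrite sizeE ltnn => short.
    by suff: false; [|apply: short; lia].
  apply: (double_step_ucycle fK f'K) => x y bx /onthP[j rowj].
  have jd : (j < d)%N.
    apply: leq_trans d_ge2; apply: (@leq_trans (size (row f f' (1 + 1)%R s x))).
      by rewrite -onthTE rowj.
    by rewrite /row; case: blob.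
  apply/(entry_edge x y gG); exists (Ordinal jd).
  have [gE|ne] := eqVneq (blob_adj d f f' (1 + 1)%R s (x, Ordinal jd)) (g (x, Ordinal jd)).
    by rewrite -gE ffunE.
  by case: none; exists (x, Ordinal jd).
have [h hP] := choice changed.
have h_inj : injective h.
  by move=> i j e; have := (hP i).1; rewrite e (hP j).1 => -[].
rewrite -[leqLHS]card_ord -(card_codom h_inj).
by apply: subset_leq_card; apply/subsetP => _ /codomP[i ->]; exact: (hP i).2.
Qed.

Lemma dist_ge_blobs (s : {perm 'I_n}) : (M <= d * n)%N ->
  M%:R / (d * n)%:R <=
    dist R (blob_adj d f f' (1 + 1)%R s) (@cycle_free (2 * k + 1) n).
Proof.
(* The first case is the starting value 1 of the minimum. *)
move=> Mdn; apply: le_bigmin => [|g' /asboolP[G g'G free]].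
  have [->|dn0] := posnP (d * n)%N; first by rewrite invr0 mulr0.
  by rewrite ler_pdivrMr ?ltr0n // mul1r ler_nat.
by rewrite ler_wpM2r ?invr_ge0 // ler_nat (changes_ge_blobs s g'G free).
Qed.

End LowerDistance.

(** * Measurability of acceptance, and averaging over coins *)

Section Measurability.
Variables (R : realType) (n d : nat) (A : algorithm R n d) (g : adjlist n d).
Local Open Scope classical_set_scope.

Lemma measurable_history l h : measurable [set w : coins A | history g w l = h].
Proof.
elim: l h => [|l IH] h.
  have [->|/eqP h0] := eqVneq h [::].
    by rewrite (_ : [set _ | _] = [set: _]) //; apply/seteqP.
  rewrite (_ : [set _ | _] = classical_sets.set0) //; apply/seteqP; split=> // w /= e.
  by rewrite e in h0.
case/lastP: h => [|h v].
  rewrite (_ : [set _ | _] = classical_sets.set0) //; apply/seteqP; split=> // w /= /eqP.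
  by rewrite -size_eq0 size_rcons.
rewrite (_ : [set _ | _] = \bigcup_(Q in [set Q | answers g Q = v])
  ([set w : coins A | history g w l = h] `&` [set w | queries w h = Q])).
  apply: fin_bigcup_measurable; first exact: finite_finset.
  by move=> Q _; apply: measurableI; [exact: IH|exact: measurable_queries].
apply/seteqP; split=> [w /= /rcons_inj[<- <-]|w [Q /= <- [<- <-]] //].
by exists (queries w (history g w l)).
Qed.

Lemma measurable_accepts l : measurable [set w : coins A | accepts l g w].
Proof.
rewrite (_ : [set _ | _] = \bigcup_(h : seq (view n d))
  ([set w : coins A | history g w l = h] `&` [set w | verdict w h])).
  apply: countable_bigcupT_measurable => [|h]; first exact: countableP.
  by apply: measurableI; [exact: measurable_history|exact: measurable_verdict].
apply/seteqP; split=> [w /= aw|w [h _ /= [<-]] //].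
by exists (history g w l).
Qed.

End Measurability.

(** A sum of probabilities is the expected number of events that occur, so the bound for each fixed
    [w] integrates. *)
Lemma sum_probability_le (R : realType) (disp : measure_display)
    (T : measurableType disp) (P : probability T R) (S : finType)
    (E1 E2 : S -> T -> bool) (b : nat) :
  (forall s, measurable [set w | E1 s w]%classic) ->
  (forall s, measurable [set w | E2 s w]%classic) ->
  (forall w, (#|[set s | E1 s w]| <= #|[set s | E2 s w]| + b)%N) ->
  (\sum_s P [set w | E1 s w]%classic <=
    \sum_s P [set w | E2 s w]%classic + b%:R%:E)%E.
Proof.
move=> m1 m2 le12.
have indE (E : S -> T -> bool) : (forall s, measurable [set w | E s w]%classic) ->
    (\sum_s P [set w | E s w]%classic =
     \int[P]_w (\sum_s (\1_[set w | E s w]%classic w)%:E))%E.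
  move=> mE; rewrite ge0_integral_sum //.
  - by apply: eq_bigr => s _; rewrite integral_indic // classical_sets.setIT.
  - by move=> s; apply/measurable_EFinP; exact: measurable_indic.
have mI (E : S -> T -> bool) : (forall s, measurable [set w | E s w]%classic) ->
    measurable_fun [set: T]%classic
      (fun w => (\sum_s (\1_[set w | E s w]%classic w)%:E)%E : \bar R).
  by move=> mE; apply: emeasurable_sum => s; apply/measurable_EFinP; exact: measurable_indic.
have I0 (E : S -> T -> bool) w : (0 <= \sum_s (\1_[set w | E s w]%classic w)%:E :> \bar R)%E.
  by apply: sume_ge0 => s _; rewrite lee_fin indicE ler0n.
have bE : (b%:R%:E = \int[P]_w (cst b%:R%:E w) :> \bar R)%E.
  rewrite integral_cst // -[LHS]mule1; congr (_ * _)%E.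
  exact/esym/probability_setT.
rewrite !indE // bE -ge0_integralD //=; first last.
- exact: mI.
apply: ge0_le_integral => //=.
- exact: mI.
- by apply: emeasurable_funD => //; exact: mI.
move=> w _.
have cntE (E : S -> T -> bool) : (\sum_s (\1_[set w | E s w]%classic w)%:E =
    (#|[set s | E s w]|%:R)%:E :> \bar R)%E.
  rewrite sumEFin card_sum_pred natr_sum; congr (_%:E); apply: eq_bigr => s _.
  rewrite indicE; case Esw: (E s w); first by rewrite mem_set.
  by rewrite memNset //= Esw.
by rewrite !cntE -EFinD lee_fin -natrD ler_nat.
Qed.

(** * Too few queries cannot separate the two families *)

Section LowerBound.
Variables (R : realType) (k M r n d : nat).
Variables (f : 'I_n -> place k M r) (f' : place k M r -> 'I_n).
Hypotheses (fK : cancel f f') (f'K : cancel f' f).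
Hypotheses (k_gt0 : (1 <= k)%N) (d_ge2 : (2 <= d)%N).
Local Notation Z := 'I_(4 * k).+2.

Lemma two_neq0 : 1 + 1 != 0 :> Z.
Proof.
have -> : 1 + 1 = 2%:R :> Z by [].
rewrite Zp_nat; apply/eqP => /(congr1 val) /=; rewrite modn_small; lia.
Qed.

Lemma four_neq0 : (1 + 1) + (1 + 1) != 0 :> Z.
Proof.
have -> : (1 + 1) + (1 + 1) = 4%:R :> Z by exact: esym (natrD Z 2 2).
rewrite Zp_nat; apply/eqP => /(congr1 val) /=; rewrite modn_small; lia.
Qed.

(** For larger [n] at most a quarter of the labellings collide. Averaged over labellings, acceptance
    would then be at least $2/3$ on long cycles yet at most $1/3+1/4$. *)
Lemma few_queries_fail (A : algorithm R n d) (q : nat) (eps : R) :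
  round_adaptive_tester A (k - 1) q eps (@cycle_free (2 * k + 1) n) ->
  (M <= d * n)%N -> eps < M%:R / (d * n)%:R ->
  (n <= 3 * q + 4 * (k * q * (3 * q * (4 * k).+2)))%N.
Proof.
rewrite /round_adaptive_tester subn1 (prednK k_gt0) => -[bound yes no] Mdn far.
rewrite leqNgt; apply/negP => large.
pose acc (e : Z) (s : {perm 'I_n}) (w : coins A) := accepts k (blob_adj d f f' e s) w.
have [p pE] : exists p, p = #|{perm 'I_n}| by exists #|{perm 'I_n}|.
have p_gt0 : (0 < p)%N by rewrite pE; apply/card_gt0P; exists 1%g.
have cnt w : (#|[set s | acc 1%R s w]| <= #|[set s | acc (1 + 1)%R s w]| + p %/ 4)%N.
  apply: leq_trans (accept_coupling fK f'K w) _; rewrite leq_add2l leq_divRL //.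
  have qb s : (num_queries k (blob_adj d f f' 1%R s) w <= q)%N.
    exact: bound (blob_represents fK f'K s two_neq0 d_ge2).
  have := card_collision fK f'K qb; rewrite -pE.
  set c := #|_|; set D := (3 * q * _)%N => cD.
  have pos : (0 < n - 3 * q)%N by lia.
  rewrite -(leq_pmul2r pos) -mulnA (mulnC 4) mulnA.
  apply: (@leq_trans (k * (p * q) * D * 4)); first by rewrite leq_mul2r cD orbT.
  have -> : (k * (p * q) * D * 4 = p * (4 * (k * q * D)))%N by ring.
  by rewrite leq_mul2l; apply/orP; right; lia.
have meas e s : measurable [set w | acc e s w]%classic := measurable_accepts A _ k.
have := sum_probability_le (coin_law A) (meas 1) (meas (1 + 1)) cnt.
have ge1 s : ((2 / 3)%:E <= coin_law A [set w | acc 1%R s w]%classic)%E.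
  apply: yes (blob_represents fK f'K s two_neq0 d_ge2) _ => c cyc c3.
  by have := unit_cycle_size cyc c3; lia.
have le2 s : (coin_law A [set w | acc (1 + 1)%R s w]%classic <= (1 / 3)%:E)%E.
  have rej : ((2 / 3)%:E <= coin_law A (~` [set w | acc (1 + 1)%R s w])%classic)%E.
    have -> : (~` [set w | acc (1 + 1)%R s w] = [set w | ~~ acc (1 + 1)%R s w])%classic.
      by apply/seteqP; split=> w /= /negP.
    apply: no (blob_represents fK f'K s four_neq0 d_ge2) _.
    exact: lt_le_trans far (dist_ge_blobs R fK f'K k_gt0 d_ge2 s Mdn).
  move: rej; rewrite probability_setC //.
  have : coin_law A [set w | acc (1 + 1)%R s w]%classic \is a fin_num by exact: fin_num_measure.
  case: (coin_law A _) => // x _; rewrite -EFinB !lee_fin; lra.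
apply/negP; rewrite -ltNge.
have sumE (c : R) : \sum_(s : {perm 'I_n}) c = c * p%:R.
  by rewrite sumr_const mulr_natr pE; congr (_ *+ _); exact: eq_card.
have lo : ((\sum_(s : {perm 'I_n}) (2 / 3 : R))%:E <=
    \sum_s coin_law A [set w | acc 1%R s w]%classic)%E.
  by rewrite -sumEFin; apply: lee_sum => s _.
have hi : (\sum_s coin_law A [set w | acc (1 + 1)%R s w]%classic <=
    (\sum_(s : {perm 'I_n}) (1 / 3 : R))%:E)%E.
  by rewrite -sumEFin; apply: lee_sum => s _.
apply: lt_le_trans lo; apply: (@le_lt_trans _ _
  ((\sum_(s : {perm 'I_n}) (1 / 3 : R))%:E + (p %/ 4)%:R%:E)%E); first exact: leeD.
rewrite -EFinD lte_fin !sumE.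
have : 4 * (p %/ 4)%:R <= p%:R :> R by rewrite -natrM ler_nat mulnC leq_trunc_div.
have : 0 < p%:R :> R by rewrite ltr0n.
lra.
Qed.

End LowerBound.

Unset Implicit Arguments.
Set Printing Implicit Defensive.

Theorem theorem5p1 (R : realType) (k d : nat) :
  (exists (C : R) (q : nat -> R -> nat)
      (T : forall n : nat, R -> algorithm R n d),
    0 < C /\
    forall (n : nat) (eps : R), (d < n)%N -> 0 < eps <= 1 ->
      [/\ (q n eps)%:R <= C / eps,
          round_adaptive_tester (T n eps) k (q n eps) eps
            (@cycle_free (2 * k + 1) n)
        & one_sided (T n eps) k (@cycle_free (2 * k + 1) n)])
  /\
  ((1 <= k)%N -> (2 <= d)%N ->
   exists (eps0 c : R) (n0 : nat),
    [/\ 0 < eps0 <= 1, 0 < c &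
    forall (n q : nat) (eps : R) (A : algorithm R n d),
      (n0 <= n)%N -> (d < n)%N -> 0 < eps <= eps0 ->
      round_adaptive_tester A (k - 1) q eps (@cycle_free (2 * k + 1) n) ->
      c * Num.sqrt n%:R <= q%:R]).
Proof.
split.
  pose m (eps : R) := (Num.truncn (2 / eps)).+1.
  (* The factor 3 comes from $m\varepsilon \le 2+\varepsilon \le 3$. *)
  exists (3 * (k.+1 * d.+1 ^ k.+1)%:R), (fun _ eps => k.+1 * (m eps * d.+1 ^ k.+1))%N,
    (fun n eps => bfs_tester d (uniform_nat R (n ^ m eps).-1)
                    (@sample n (m eps)) (2 * k + 1)).
  split=> [|n eps dn eps01]; first by rewrite mulr_gt0 // ltr0n muln_gt0 expn_gt0.
  have [e0 e1] := andP eps01.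
  have e2 : 0 <= 2 / eps by rewrite divr_ge0 // ltW.
  have me : 2 <= (m eps)%:R * eps.
    by rewrite -ler_pdivrMr // ltW // /m truncnS_gt.
  have [tester sided] := bfs_tester_correct d k (leq_ltn_trans (leq0n d) dn) eps01 me.
  split=> //; rewrite mulnCA natrM [leRHS]mulrAC ler_wpM2r //.
  rewrite ler_pdivlMr // /m -natr1 mulrDl mul1r.
  have : (Num.truncn (2 / eps))%:R <= 2 / eps by rewrite truncn_le.
  rewrite ler_pdivlMr //; lra.
move=> k_gt0 d_ge2; pose N := (4 * k).+2.
(* Chosen so that the bound of [few_queries_fail] is at most $Kq^2$, using $q \le q^2$ for its
   linear term. *)
pose K := (3 + 12 * k * (3 * N))%N.
have N0 : 0 < N%:R :> R by rewrite ltr0n.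
have d0 : 0 < d%:R :> R by rewrite ltr0n; lia.
have K0 : 0 < K%:R :> R by rewrite ltr0n.
(* For $n \ge N$ there are at least $n/(2N)$ blobs, so the distance is at least $1/(2dN)$, strictly
   above $1/(4dN)$. *)
exists (4 * d%:R * N%:R)^-1, (Num.sqrt K%:R)^-1, N; split.
- rewrite invr_gt0 !mulr_gt0 //= invf_le1 ?mulr_gt0 // -!natrM ler1n !muln_gt0; lia.
- by rewrite invr_gt0 sqrtr_gt0.
move=> n q eps A Nn dn /andP[_ eps_le] test.
have place_card : #|place k (n %/ N) (n %% N)| = n.
  by rewrite card_sum card_prod !card_ord -divn_eq.
pose f (x : 'I_n) : place k (n %/ N) (n %% N) := enum_val (cast_ord (esym place_card) x).
pose f' v : 'I_n := cast_ord place_card (enum_rank v).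
have fK : cancel f f' by move=> x; rewrite /f' /f enum_valK cast_ordKV.
have f'K : cancel f' f by move=> v; rewrite /f' /f cast_ordK enum_rankK.
have Mdn : (n %/ N <= d * n)%N.
  by apply: leq_trans (leq_div _ _) _; rewrite leq_pmull //; lia.
have n0 : 0 < n%:R :> R by rewrite ltr0n; lia.
have n_le : (n <= 2 * (n %/ N) * N)%N.
  have M1 : (0 < n %/ N)%N by rewrite divn_gt0.
  have := divn_eq n N; have := ltn_pmod n (isT : 0 < N)%N; nia.
have far : eps < (n %/ N)%:R / (d * n)%:R.
  apply: le_lt_trans eps_le _.
  rewrite natrM ltr_pdivlMr ?mulr_gt0 // mulrC ltr_pdivrMr ?mulr_gt0 //.
  have : n%:R <= 2 * (n %/ N)%:R * N%:R :> R by rewrite -!natrM ler_nat.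
  nra.
have nq := few_queries_fail fK f'K k_gt0 d_ge2 test Mdn far.
have nKq : (n <= K * q ^ 2)%N by rewrite /K -mulnn; move: nq; rewrite -/N; nia.
rewrite mulrC ler_pdivrMr ?sqrtr_gt0 //.
rewrite -[q%:R]ger0_norm // -sqrtr_sqr -sqrtrM ?exprn_ge0 //.
by rewrite ler_sqrt ?mulr_ge0 // mulrC -natrX -natrM ler_nat.
Qed.
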